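(* Let $S=\{s_2,s_1\}$ with $s_1>s_2$ positive integers. Then for every $x\ge s_2$, $\mathrm{opt}(x)=s_2$ if and only if $x\in X^*$.
   Context: Cumulative subtraction (CS): $S$ is a finite set of positive integers with $|S|\ge 2$. Starting from a heap of $x\in\mathbb{Z}_{\ge 0}$ pebbles and score $0$, two players, Positive (who starts) and Negative, alternate in removing $s\in S$ pebbles, with $s$ at most the current heap size; Positive's move adds $s$ to the score and Negative's move subtracts $s$. The game ends when the heap is smaller than $\min S$. Positive maximizes and Negative minimizes the terminal score. Outcome function: $o:\mathbb{Z}_{\ge 0}\to\mathbb{Z}$ is defined recursively by $o(x)=0$ if $x<\min S$ and $o(x)=\max\{s-o(x-s)\mid s\in S,\ s\le x\}$ if $x\ge\min S$. Optimal action: for $x\ge\min S$, $\mathrm{opt}(x)$ is the largest $s\in S$ with $s\le x$ and $o(x)=s-o(x-s)$. The set $X^*$: for $S=\{s_2,s_1\}$ with $s_1>s_2$, put $\alpha=s_1-s_2$ and $\Delta=\{0,1,\ldots,\alpha-1\}$. For each integer $i\ge 1$ with $is_2>(i-1)s_1$, let $X^*(i)=\{is_2+(i-1)s_1+\delta\mid\delta\in\Delta\}$; for all other $i\ge 1$ let $X^*(i)=\varnothing$. Let $X^*=\bigcup_{i\ge 1}X^*(i)$. *)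

(* Defs.v *)
From mathcomp Require Import all_boot all_order all_algebra.
From mathcomp Require Import finmap classical_sets.

Set Implicit Arguments.
Unset Strict Implicit.
Unset Printing Implicit Defensive.

Import Order.TTheory GRing.Theory Num.Theory.

Local Open Scope fset_scope.
Local Open Scope nat_scope.

(* The starting value of the iterated minimum is an element of S (when S is
   nonempty), so this is min S. *)
Definition min_move (S : {fset nat}) : nat :=
  \big[minn/head 0 (enum_fset S)]_(s <- S) s.

(* Bounded unfolding of the recursion for o.  The starting value of the iterated
   maximum is the term of s = min S, which is itself one of the candidates when
   min S <= x, so this is the maximum over {s in S | s <= x}. *)
Fixpoint outcome_rec (S : {fset nat}) (fuel x : nat) : int :=
  if fuel is n.+1 then
    if x < min_move S then 0%R else
    let value s := (s%:Z - outcome_rec S n (x - s))%R in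
    \big[Order.max/value (min_move S)]_(s <- S | s <= x) value s
  else 0%R.

(* When 0 is not in S each move decreases x, so x.+1 unfoldings suffice:
   see outcome_small and outcomeE. *)
Definition outcome (S : {fset nat}) (x : nat) : int := outcome_rec S x.+1 x.

(* The maximum of an empty family is 0, but opt is only meaningful for
   min S <= x, where the family is nonempty: see optP. *)
Definition opt (S : {fset nat}) (x : nat) : nat :=
  \max_(s <- S | (s <= x) && (outcome S x == s%:Z - outcome S (x - s))%R) s.

Definition Xstar_block (s2 s1 i : nat) : set nat :=
  if (i - 1) * s1 < i * s2 then
    [set x | exists2 d : nat, d < s1 - s2 & x = i * s2 + (i - 1) * s1 + d]%classic
  else set0.

Definition Xstar (s2 s1 : nat) : set nat :=
  (\bigcup_(i in [set i | 1 <= i]) Xstar_block s2 s1 i)%classic.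

Lemma min_move_le (S : {fset nat}) s : s \in S -> min_move S <= s.
Proof.
rewrite /min_move -[s \in S]/(s \in enum_fset S).
move: (head _ _) => m; elim: (enum_fset S) => // a l IH.
rewrite big_cons inE => /predU1P[->|/IH]; first exact: geq_minl.
by apply: leq_trans; apply: geq_minr.
Qed.

Lemma min_move_in (S : {fset nat}) : S != fset0 -> min_move S \in S.
Proof.
case/fset0Pn => s0 Ss0.
have head_in (l : seq nat) : s0 \in l -> head 0 l \in l.
  by case: l => //= a l _; apply: mem_head.
have S_head : head 0 (enum_fset S) \in S := head_in (enum_fset S) Ss0.
rewrite /min_move big_seq; elim/big_ind: _ => // a b Ha Hb.
by rewrite /minn; case: ifP.
Qed.

Lemma outcome_small (S : {fset nat}) x : x < min_move S -> outcome S x = 0%R.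
Proof. by rewrite /outcome /= => ->. Qed.

Lemma outcome_rec_enough (S : {fset nat}) n m x : S != fset0 -> 0 \notin S ->
  x < n -> x < m -> outcome_rec S n x = outcome_rec S m x.
Proof.
move=> S0 S_pos; elim: n m x => // n IH [|m] // x xn xm /=.
case: ltnP => // mx.
have E s : s \in S -> s <= x ->
    outcome_rec S n (x - s) = outcome_rec S m (x - s).
  move=> Ss sx; have s_gt0 : 0 < s by case: s Ss {sx} => // /(negP S_pos).
  have lt_x : x - s < x by rewrite ltn_subrL s_gt0 (leq_trans s_gt0).
  by apply: IH; apply: leq_trans lt_x _.
rewrite (E _ (min_move_in S0) mx) big_seq_cond [RHS]big_seq_cond.
by apply: eq_bigr => s /andP[Ss sx]; rewrite E.
Qed.

Lemma outcomeE (S : {fset nat}) x : S != fset0 -> 0 \notin S ->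
  min_move S <= x ->
  (exists s, [/\ s \in S, s <= x & outcome S x = (s%:Z - outcome S (x - s))%R])
  /\ (forall s, s \in S -> s <= x ->
        (s%:Z - outcome S (x - s) <= outcome S x)%R).
Proof.
move=> S0 S_pos mx.
have Sm := min_move_in S0.
have E s : s \in S -> s <= x -> outcome_rec S x (x - s) = outcome S (x - s).
  move=> Ss sx; have s_gt0 : 0 < s by case: s Ss {sx} => // /(negP S_pos).
  by apply: outcome_rec_enough => //; rewrite ltn_subrL s_gt0 (leq_trans s_gt0).
have -> : outcome S x =
    \big[Order.max/((min_move S)%:Z - outcome S (x - min_move S))%R]_(s <- S | s <= x)
      (s%:Z - outcome S (x - s))%R.
  rewrite {1}/outcome /= ltnNge mx /= (E _ Sm mx) big_seq_cond [RHS]big_seq_cond.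
  by apply: eq_bigr => s /andP[Ss sx]; rewrite E.
split; last first.
  move=> s Ss sx.
  exact: (le_bigmax_seq _ s (fun t => t <= x)
            (fun t => t%:Z - outcome S (x - t))%R).
rewrite big_seq_cond; elim/big_ind: _ => [|a b Ha Hb|s /andP[Ss sx]].
- by exists (min_move S).
- by rewrite /Order.max; case: ifP.
- by exists s.
Qed.

Lemma optP (S : {fset nat}) x : S != fset0 -> 0 \notin S -> min_move S <= x ->
  [/\ opt S x \in S, opt S x <= x,
      outcome S x = ((opt S x)%:Z - outcome S (x - opt S x))%R
    & forall s, s \in S -> s <= x ->
        outcome S x = (s%:Z - outcome S (x - s))%R -> s <= opt S x].
Proof.
move=> S0 S_pos mx; have [[s0 [Ss0 s0x Es0]] _] := outcomeE S0 S_pos mx.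
have max_opt s : s \in S -> s <= x ->
    outcome S x = (s%:Z - outcome S (x - s))%R -> s <= opt S x.
  move=> Ss sx /eqP Es.
  have Ps : (s <= x) && (outcome S x == s%:Z - outcome S (x - s))%R by rewrite sx.
  exact: (@leq_bigmax_seq _ _
    (fun t => (t <= x) && (outcome S x == t%:Z - outcome S (x - t))%R) id s Ss Ps).
suff [? ? ?] : [/\ opt S x \in S, opt S x <= x &
    outcome S x = ((opt S x)%:Z - outcome S (x - opt S x))%R] by split.
have := max_opt _ Ss0 s0x Es0.
have s0_gt0 : 0 < s0 by case: (s0) Ss0 => // /(negP S_pos).
move/(leq_trans s0_gt0); rewrite /opt big_seq_cond.
elim/big_ind: _ => [//|a b Ha Hb|s /and3P[Ss sx /eqP Es] _]; last by [].
by rewrite /maxn; case: ifP.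
Qed.

(* Main.v *)
(* Write a = s_2, b = s_1, c = b - a, p = a + b. For x >= b the move a is strictly
   better than b iff o (x - b) - o (x - a) > c, and strong induction on x shows
   that this happens exactly on X*.
   On the block X* (j + 1), o = a - jc, because playing a and then b leads to the
   previous block at a cost of c. Hence for x in that block with j >= 1 we have
   o (x - a) = jc, whereas a chain of b-moves from x - 2b shows o (x - 2b) = 0 and
   so o (x - b) = b; the difference b - jc exceeds c since jc < a.
   Off X*, the inequality o (y) <= o (y + c) + c for y = x - b is reduced, by
   playing b from both heaps, to o (z + c) <= o (z) + c for z = x - 2b; this
   holds by comparing o (z + c) = b - o (z - a) with o (z) >= a - o (z - a), and
   where z + c is itself in a block, by the value of o there. *)
Require Import Defs.
From mathcomp Require Import all_boot all_order all_algebra.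
From mathcomp Require Import finmap classical_sets.
From mathcomp Require Import zify.

Local Open Scope fset_scope.
Local Open Scope nat_scope.

Section TwoMoves.

(* a = s_2, c = alpha, b = s_1. *)
Variables a c : nat.
Local Notation b := (a + c).
Local Notation p := (a + b).

(* X* (i) with i = j + 1 is the set of jp + r with a <= r < b; it is nonempty
   iff (j + 1)a > jb, that is jc < a. *)
Definition in_block (x : nat) : bool :=
  [&& a <= x %% p, x %% p < b & x %/ p * c < a].

Lemma in_blockMD j r : r < p ->
  in_block (j * p + r) = [&& a <= r, r < b & j * c < a].
Proof.
move=> rp; have p0 : 0 < p by lia.
by rewrite /in_block modnMDl modn_small // divnMDl // divn_small // addn0.
Qed.

Lemma in_blockP x :
  reflect (exists j r, [/\ a <= r, r < b, j * c < a & x = j * p + r])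
          (in_block x).
Proof.
apply: (iffP idP) => [/and3P[ar rb jc]|[j [r [ar rb jc ->]]]].
  by exists (x %/ p), (x %% p); split=> //; apply: divn_eq.
by rewrite in_blockMD ?ar ?rb //; lia.
Qed.

Hypothesis a_gt0 : 0 < a.
Hypothesis c_gt0 : 0 < c.
(** Only these consequences of the recursion are used; heaps are written as sums to avoid truncated
    subtraction. *)
Variable o : nat -> int.
Hypothesis o_small : forall x, x < a -> o x = 0%R.
Hypothesis o_mid : forall x, x < c -> o (x + a) = (a%:Z - o x)%R.
Hypothesis o_ge_a : forall x, (a%:Z - o x <= o (x + a)%N)%R.
Hypothesis o_ge_b : forall x, (b%:Z - o x <= o (x + b)%N)%R.
Hypothesis o_or : forall x,
  o (x + b) = (b%:Z - o x)%R \/ o (x + b) = (a%:Z - o (x + c)%N)%R.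

Lemma o_bounds_small x : x < b -> (0 <= o x <= a%:Z)%R.
Proof.
elim/ltn_ind: x => x IH xb.
have [xa|ax] := ltnP x a; first by rewrite o_small; lia.
have := o_mid (x - a); have := IH (x - a); rewrite subnK //; lia.
Qed.

Lemma o_bounds x : (0 <= o x <= b%:Z)%R.
Proof.
elim/ltn_ind: x => x IH.
have [/o_bounds_small|bx] := ltnP x b; first by lia.
have := o_ge_b (x - b); have := o_or (x - b).
have := IH (x - b); have := IH (x - b + c); rewrite subnK //; lia.
Qed.

(** Compares the moves on the heap [x + b]: in a block [a] is strictly better, elsewhere [b] is
    optimal, possibly tied. *)
Definition optimal_at (x : nat) : bool :=
  if in_block (x + b) then (o (x + c)%N + c%:Z < o x)%R
  else o (x + b) == (b%:Z - o x)%R.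

Section BelowN.

Variable n : nat.
Hypothesis IHn : forall y, y < n -> optimal_at y.

Lemma optimal_out j r y : r < a -> j * p + r = y + b -> y < n ->
  o (y + b) = (b%:Z - o y)%R.
Proof.
move=> ra e /IHn; rewrite /optimal_at -e in_blockMD; last by lia.
by rewrite leqNgt ra => /eqP.
Qed.

(* Subtracting 2b passes from (j + 1)p + r to jp + (r - c), so the greedy play
   by b reaches the region below a, where the outcome is 0, after an even number
   of moves. *)
Lemma o_zero j r : j * c <= r -> r < a -> j * p + r < n + b ->
  o (j * p + r)%N = 0%R.
Proof.
elim: j r => [|j IH] r jr ra lt; first by apply: o_small; lia.
have e : j.+1 * p + r = j * p + (r - c) + b + b by lia.
have o0 : o (j * p + (r - c)) = 0%R by apply: IH; lia.
have := optimal_out j.+1 r _ ra e; rewrite e.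
have := o_bounds (j * p + (r - c) + b + b).
have := o_ge_b (j * p + (r - c)); lia.
Qed.

(** For the step, let [y = j * p + r + a]. The claim at [y] bounds both options by [a - o (y + c)],
    and playing [b] from [y + c] leads back to [j * p + r]. *)
Lemma o_block_le j r : a <= r -> r < b -> j * c < a -> j * p + r < n + b ->
  (o (j * p + r)%N <= a%:Z - (j * c)%:Z)%R.
Proof.
move=> ar rb; elim: j => [|j IH] jc lt.
  have := o_mid (r - a); have := o_bounds (r - a).
  rewrite subnK // mul0n add0n; lia.
have {}IH : (o (j * p + r)%N <= a%:Z - (j * c)%:Z)%R by apply: IH; lia.
have e : j.+1 * p + r = j * p + r + a + b by lia.
have := IHn (j * p + r + a); rewrite /optimal_at -e in_blockMD; last by lia.
rewrite ar rb jc /= => IHy.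
have := o_or (j * p + r + a); rewrite -e.
have -> : j * p + r + a + c = j * p + r + b by lia.
move: IHy; have -> : j * p + r + a + c = j * p + r + b by lia.
have := o_ge_b (j * p + r); have := o_ge_b (j * p + r + a); rewrite -e; lia.
Qed.

Lemma o_block_ge j r : c <= a -> a <= r -> r < b -> j * p + r < n + p ->
  (a%:Z - (j * c)%:Z <= o (j * p + r)%N)%R.
Proof.
move=> ca ar rb; elim: j => [|j IH] lt.
  have := o_mid (r - a); have := o_small (r - a).
  rewrite subnK // mul0n add0n; lia.
have {}IH : (a%:Z - (j * c)%:Z <= o (j * p + r)%N)%R by apply: IH; lia.
have e : j.+1 * p + r = j * p + r + b + a by lia.
have e' : j.+1 * p + (r - a) = j * p + r + b by lia.
have := optimal_out j.+1 (r - a) _ _ e'.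
have := o_ge_a (j * p + r + b); rewrite -e; lia.
Qed.

Lemma optimal_in : in_block (n + b) -> (o (n + c)%N + c%:Z < o n)%R.
Proof.
case/in_blockP => -[|j] [r [ar rb jc e]]; first by lia.
have en : n = j * p + (r - c) + b by lia.
have o0 : o (j * p + (r - c)) = 0%R by apply: o_zero; lia.
have ec : n + c = j * p + r + b by lia.
have e' : j.+1 * p + (r - a) = j * p + r + b by lia.
have := optimal_out j.+1 (r - a) _ _ e'; rewrite -ec.
have := o_ge_b (j * p + (r - c)); rewrite -en.
have := o_block_ge j r; lia.
Qed.

(* The claim fails when z + 2b lies in a block: there o z = 0 while z + c lies
   in the previous block. *)
Lemma o_shift_le z : z + b <= n -> ~~ in_block (z + b + b) ->
  (o (z + c)%N <= o z + c%:Z)%R.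
Proof.
move=> zn zX; have oz := o_bounds z.
have [zca|azc] := ltnP (z + c) a; first by rewrite o_small; lia.
have [za|az] := ltnP z a.
  have := o_mid (z + c - a); have := o_bounds (z + c - a); rewrite subnK //.
  have [ac|ca] := leqP a c; first by lia.
  case/negP: zX; have -> : z + b + b = 1 * p + (z + c) by lia.
  by rewrite in_blockMD; lia.
have e : z + c = z - a + b by lia.
have := IHn (z - a); rewrite /optimal_at -e.
case: ifP => [/in_blockP[j [r [ar rb jc ej]]] _|_].
  have := o_block_le j r ar rb jc; rewrite -ej.
  (* Either the next block is empty, and then [a - j * c <= c], or it contains [z + b + b]. *)
  have [?|jc'] := leqP a (j.+1 * c); first by lia.
  case/negP: zX; have -> : z + b + b = j.+1 * p + r by lia.
  by rewrite in_blockMD; lia.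
have := o_ge_a (z - a); rewrite subnK //; lia.
Qed.

Lemma optimal_step : optimal_at n.
Proof.
rewrite /optimal_at; case: ifP => [|/negbT nX]; first exact: optimal_in.
suff : (o n <= o (n + c)%N + c%:Z)%R.
  by have := o_or n; have := o_ge_b n; lia.
have onc := o_bounds (n + c).
have [na|an] := ltnP n a; first by rewrite o_small; lia.
have e : n + c = n - a + b by lia.
have := o_ge_b (n - a); rewrite -e.
have [nb|bn] := ltnP n b.
  have := o_mid (n - a); rewrite subnK //; lia.
have en : n - b + b = n by lia.
have ena : n - b + c = n - a by lia.
(* If [a] attains [o n], the bound [b - o (n - a) <= o (n + c)] suffices; if [b] does, the shift
   bounds [o (n - a)] by [o (n - b) + c]. *)
have := o_shift_le (n - b); have := o_or (n - b); rewrite en ena; lia.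
Qed.

End BelowN.

Lemma optimal_everywhere x : optimal_at x.
Proof. by elim/ltn_ind: x => x; apply: optimal_step. Qed.

End TwoMoves.

Lemma Xstar_in_block a c x : Xstar a (a + c) x <-> in_block a c x.
Proof.
split=> [[i i_gt0]|/in_blockP[j [r [ar rb jc ->]]]].
  rewrite /Xstar_block; case: ifP => // lt_i [d d_lt ->].
  apply/in_blockP; exists i.-1, (a + d).
  by case: i i_gt0 lt_i => //= i; split; lia.
exists j.+1 => //; rewrite /Xstar_block.
have -> : (j.+1 - 1) * (a + c) < j.+1 * a by lia.
by exists (r - a); lia.
Qed.

Lemma min_move2 s2 s1 : s2 <= s1 -> min_move [fset s2; s1] = s2.
Proof.
move=> le_s; have S0 : [fset s2; s1] != fset0.
  by apply/fset0Pn; exists s2; rewrite !inE eqxx.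
have := min_move_in S0; have := @min_move_le [fset s2; s1] s2.
rewrite !inE eqxx /= => /(_ isT) ge /orP[] /eqP; lia.
Qed.

Theorem theorem12 (s2 s1 : nat) (s2_gt0 : 0 < s2) (lt_s2_s1 : s2 < s1)
    (x : nat) (le_s2_x : s2 <= x) :
  opt [fset s2; s1] x = s2 <-> Xstar s2 s1 x.
Proof.
have [c c_gt0 ->] : exists2 c, 0 < c & s1 = s2 + c by exists (s1 - s2); lia.
rewrite Xstar_in_block; set S := [fset s2; s2 + c]; set o := outcome S.
have inS s : s \in S = (s == s2) || (s == s2 + c) by rewrite !inE.
have S2 : s2 \in S by rewrite inS eqxx.
have S1 : s2 + c \in S by rewrite inS eqxx orbT.
have S_neq0 : S != fset0 by apply/fset0Pn; exists s2.
have S_pos : 0 \notin S by rewrite inS; lia.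
have minS : min_move S = s2 by apply: min_move2; lia.
have oE y : s2 <= y ->
    (exists s : nat, [/\ s \in S, s <= y & o y = (s%:Z - o (y - s)%N)%R]) /\
    (forall s : nat, s \in S -> s <= y -> (s%:Z - o (y - s)%N <= o y)%R).
  by move=> le_y; apply: outcomeE => //; rewrite minS.
have o_small y : y < s2 -> o y = 0%R.
  by move=> lt_y; apply: outcome_small; rewrite minS.
have o_mid y : y < c -> o (y + s2) = (s2%:Z - o y)%R.
  move=> lt_y; have [|[s []]] := oE (y + s2); first by lia.
  by rewrite inS => /orP[] /eqP-> le_s; [rewrite addnK | lia].
have o_ge_a y : (s2%:Z - o y <= o (y + s2)%N)%R.
  by have [|_ /(_ s2 S2)] := oE (y + s2); rewrite ?addnK; lia.
have o_ge_b y : ((s2 + c)%:Z - o y <= o (y + (s2 + c))%N)%R.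
  by have [|_ /(_ _ S1)] := oE (y + (s2 + c)); rewrite ?addnK; lia.
have o_or y : o (y + (s2 + c)) = ((s2 + c)%:Z - o y)%R \/
    o (y + (s2 + c)) = (s2%:Z - o (y + c)%N)%R.
  have [|[s []]] := oE (y + (s2 + c)); first by lia.
  have e : y + (s2 + c) - s2 = y + c by lia.
  by rewrite inS => /orP[] /eqP-> _; rewrite ?addnK ?e; [right | left].
have optimal := optimal_everywhere s2 c s2_gt0 c_gt0 o o_small o_mid
  o_ge_a o_ge_b o_or.
have [|optS opt_le optE opt_max] := @optP S x S_neq0 S_pos.
  by rewrite minS.
move: optS; rewrite inS.
have [x_lt|x_ge] := ltnP x (s2 + c).
  (* Here [s2] is the only legal move, and [x] lies in the first block. *)
  have -> : in_block s2 c x by apply/in_blockP; exists 0, x; split; lia.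
  by lia.
have [y ex] : exists y, x = y + (s2 + c) by exists (x - (s2 + c)); lia.
have := optimal y; rewrite /optimal_at -ex; case: ifP => _.
  move=> lt_o /orP[] /eqP opt_eq; first by [].
  move: optE; rewrite -/o opt_eq ex addnK; have := o_ge_a (y + c).
  have -> : y + c + s2 = y + (s2 + c) by lia.
  by lia.
(* Since [opt] breaks ties towards the larger move, optimality of [s2 + c] already excludes [s2]. *)
move=> /eqP eq_o _; split=> // opt_eq.
by have := opt_max _ S1 x_ge; rewrite -/o {2}ex addnK opt_eq => /(_ eq_o); lia.
Qed.
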